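(* Let $V$ be a $d'$-dimensional irreducible $\triangle_q$-module that has a marginal weight. Then there exists $(a,b,c,\lambda,\delta)\in(\mathbb F^\times)^4\times\mathbb F$ such that the $\triangle_q$-module $W_\lambda^\delta(a,b,c)$ is isomorphic to $V$.
   Context: $\mathbb F$ is an algebraically closed field and $q\in\mathbb F^\times$ is a root of unity of order $d$ with $d\notin\{1,2,4\}$. Put $d'=d$ if $d$ is odd and $d'=d/2$ if $d$ is even (the order of $q^2$). The universal Askey–Wilson algebra $\triangle_q$ is the unital associative $\mathbb F$-algebra with generators $A,B,C$ subject to the relations that each of $A+\frac{qBC-q^{-1}CB}{q^2-q^{-2}}$, $B+\frac{qCA-q^{-1}AC}{q^2-q^{-2}}$, $C+\frac{qAB-q^{-1}BA}{q^2-q^{-2}}$ is central; let $\alpha,\beta,\gamma$ be these three central elements multiplied by $q+q^{-1}$. For a $\triangle_q$-module $V$ and $\mu\in\mathbb F^\times$ let $V(\mu)=\{v\in V: Bv=(\mu+\mu^{-1})v\}$; $\mu$ is a weight of $V$ if $V(\mu)\ne0$. A weight $\mu$ is marginal if there is a nonzero $v\in V(\mu)$ with $(B-\mu q^2-\mu^{-1}q^{-2})(B-\mu-\mu^{-1})Av=0$. For $(a,b,c,\lambda)\in(\mathbb F^\times)^4$ and $i\in\mathbb N$ set $\theta_i=a\lambda^{-1}q^{2i}+a^{-1}\lambda q^{-2i}$, $\theta_i^*=b\lambda^{-1}q^{2i}+b^{-1}\lambda q^{-2i}$, $\varphi_i=a^{-1}b^{-1}\lambda q(q^i-q^{-i})(\lambda^{-1}q^{i-1}-\lambda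 q^{1-i})(q^{-i}-abc\lambda^{-1}q^{i-1})(q^{-i}-abc^{-1}\lambda^{-1}q^{i-1})$. The Verma module $M_\lambda(a,b,c)$ is the $\triangle_q$-module with basis $\{m_i\}_{i\in\mathbb N}$ with $(A-\theta_i)m_i=m_{i+1}$, $(B-\theta_i^* )m_i=\varphi_im_{i-1}$ ($m_{-1}$ arbitrary), and $\alpha,\beta,\gamma$ acting as the scalars $(b+b^{-1})(c+c^{-1})+(a+a^{-1})(\lambda q+\lambda^{-1}q^{-1})$, $(c+c^{-1})(a+a^{-1})+(b+b^{-1})(\lambda q+\lambda^{-1}q^{-1})$, $(a+a^{-1})(b+b^{-1})+(c+c^{-1})(\lambda q+\lambda^{-1}q^{-1})$. For $\delta\in\mathbb F$ the span $O_\lambda^\delta(a,b,c)$ of $\{\delta m_i-m_{d'+i}\}_{i\in\mathbb N}$ is a submodule and $W_\lambda^\delta(a,b,c):=M_\lambda(a,b,c)/O_\lambda^\delta(a,b,c)$, a $d'$-dimensional $\triangle_q$-module. *)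

(* Defs.v *)
From HB Require Import structures.
From mathcomp Require Import all_boot all_order all_algebra.
Set Implicit Arguments. Unset Strict Implicit. Unset Printing Implicit Defensive.
Import Order.TTheory GRing.Theory Num.Theory.
Local Open Scope ring_scope.

(* Convention: a finite-dimensional (n-dimensional) Delta_q-module is F^n
   (column vectors 'cV_n) with generators acting by left multiplication by
   matrices A, B, C : 'M_n. *)

Section DeltaQ.
Variable F : fieldType.
Variable q : F.

(* order of q^2 *)
Definition dprime (d : nat) : nat := if odd d then d else d./2.

Definition qcomm n (X Y : 'M[F]_n) : 'M[F]_n :=
  (q ^+ 2 - q ^- 2)^-1 *: (q *: (X *m Y) - q^-1 *: (Y *m X)).

Definition mcomm n (X Y : 'M[F]_n) : Prop := X *m Y = Y *m X.

Definition OmA n (A B C : 'M[F]_n) := A + qcomm B C.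
Definition OmB n (A B C : 'M[F]_n) := B + qcomm C A.
Definition OmC n (A B C : 'M[F]_n) := C + qcomm A B.

(* (A,B,C) define a Delta_q-module structure on F^n: each of the three
   elements is central, i.e. commutes with the generators A, B, C. *)
Definition is_DeltaQ_module n (A B C : 'M[F]_n) : Prop :=
  forall Om : 'M[F]_n, Om \in [:: OmA A B C; OmB A B C; OmC A B C] ->
    [/\ mcomm Om A, mcomm Om B & mcomm Om C].

(* irreducible: the only subspaces of F^n (column vectors) invariant under
   A, B, C are 0 and F^n.  A subspace of column vectors is encoded by the
   row space of U : 'M_n (its rows are the transposed vectors); the column
   vector u^T is sent by A to A u^T = (u A^T)^T. *)
Definition is_irreducible n (A B C : 'M[F]_n) : Prop :=
  (0 < n)%N /\
  forall U : 'M[F]_n,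
    stablemx U A^T -> stablemx U B^T -> stablemx U C^T ->
    U = 0 \/ row_full U.

Definition is_marginal_weight n (A B C : 'M[F]_n) (mu : F) : Prop :=
  mu != 0 /\
  exists v : 'cV[F]_n, [/\ v != 0,
    B *m v = (mu + mu^-1) *: v &
    (B - (mu * q ^+ 2 + mu^-1 * q ^- 2)%:M) *m (B - (mu + mu^-1)%:M) *m (A *m v)
      = 0].

Definition mod_isomorphic n (A B C A' B' C' : 'M[F]_n) : Prop :=
  exists2 P : 'M[F]_n, P \in unitmx &
    [/\ P *m A = A' *m P, P *m B = B' *m P & P *m C = C' *m P].

Definition theta (a lam : F) (i : nat) : F :=
  a * lam^-1 * q ^+ (2 * i) + a^-1 * lam * q ^- (2 * i).
Definition theta_s (b lam : F) (i : nat) : F :=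
  b * lam^-1 * q ^+ (2 * i) + b^-1 * lam * q ^- (2 * i).
(* q^{i-1} = q^i / q ,  q^{1-i} = q / q^i *)
Definition phi (a b c lam : F) (i : nat) : F :=
  a^-1 * b^-1 * lam * q * (q ^+ i - q ^- i)
  * (lam^-1 * (q ^+ i / q) - lam * (q / q ^+ i))
  * (q ^- i - a * b * c * lam^-1 * (q ^+ i / q))
  * (q ^- i - a * b * c^-1 * lam^-1 * (q ^+ i / q)).

(* scalar by which gamma acts on M_lambda(a,b,c) *)
Definition gammaV (a b c lam : F) : F :=
  (a + a^-1) * (b + b^-1) + (c + c^-1) * (lam * q + lam^-1 * q^-1).

(* W_lambda^delta(a,b,c) = M_lambda(a,b,c)/O_lambda^delta(a,b,c), written in
   the basis (images of) m_0, ..., m_{n-1} (n = d'); column j = image of m_j.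
   A m_j = theta_j m_j + m_{j+1}, with m_n = delta m_0 in the quotient;
   B m_j = theta*_j m_j + phi_j m_{j-1};
   C is determined by gamma = (q+q^{-1})(C + (qAB-q^{-1}BA)/(q^2-q^{-2})). *)
Definition W_A n (a lam delta : F) : 'M[F]_n :=
  \matrix_(i < n, j < n)
    ((i == j :> nat)%:R * theta a lam j + (i == j.+1 :> nat)%:R
     + ((i == 0%N :> nat) && (j == n.-1 :> nat))%:R * delta).
Definition W_B n (a b c lam : F) : 'M[F]_n :=
  \matrix_(i < n, j < n)
    ((i == j :> nat)%:R * theta_s b lam j
     + (i.+1 == j :> nat)%:R * phi a b c lam j).
Definition W_C n (a b c lam delta : F) : 'M[F]_n :=
  (gammaV a b c lam / (q + q^-1))%:M - qcomm (W_A n a lam delta) (W_B n a b c lam).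

End DeltaQ.

(* Main.v *)
Require Import Defs.
From HB Require Import structures.
From mathcomp Require Import all_boot all_order all_algebra.
From mathcomp Require Import ring.
Set Implicit Arguments. Unset Strict Implicit. Unset Printing Implicit Defensive.
Import GRing.Theory.
Local Open Scope ring_scope.

(* By Schur's lemma the three central elements act as scalars.  A marginal weight mu
   yields a vector v in V(mu) with (B - theta*_1) A v = kappa v.  Over an algebraically
   closed field one can choose (a, b, c, lam) with b / lam = mu matching kappa, beta and
   gamma; alpha is then never needed.  The Askey-Wilson relation expressing B A^2 shows
   that the vectors m_i = (A - theta_(i-1)) ... (A - theta_0) v satisfy the relations of
   the Verma basis.  By Cayley-Hamilton m_0, ..., m_(d'-1) span a submodule, hence form
   a basis of V.  Since theta, theta* and phi are d'-periodic, the operator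
   (A - theta_(d'-1)) ... (A - theta_0), which sends m_i to m_(d'+i), commutes with A
   and B, so it is a scalar delta. *)

(** * Polynomial equations over an algebraically closed field *)

Section Scalars.
Variable F : closedFieldType.
Implicit Types x y : F.

Lemma closed_quadratic (s t : F) : exists x, x ^+ 2 = s * x + t.
Proof.
have [x ex] := @solve_monicpoly F 2 (nth 0 [:: t; s]) isT.
by exists x; rewrite ex !big_ord_recl big_ord0 /=; ring.
Qed.

Lemma closed_cubic (r s t : F) : exists x, x ^+ 3 = r * x ^+ 2 + s * x + t.
Proof.
have [x ex] := @solve_monicpoly F 3 (nth 0 [:: t; s; r]) isT.
by exists x; rewrite ex !big_ord_recl big_ord0 /=; ring.
Qed.

Lemma ex_add_inv y : exists2 x, x != 0 & x + x^-1 = y.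
Proof.
have [x ex] := closed_quadratic y (-1).
have x0 : x != 0.
  apply/eqP => x0; move: ex; rewrite x0 expr0n mulr0 add0r => /eqP.
  by rewrite eq_sym oppr_eq0 oner_eq0.
exists x => //; apply: (mulIf x0).
by rewrite mulrDl mulVf // -expr2 ex subrK.
Qed.

Lemma ex_sqrt_neq0 y : y != 0 -> exists2 x, x != 0 & x ^+ 2 = y.
Proof.
move=> y0; have [x ex] := closed_quadratic 0 y; rewrite mul0r add0r in ex.
by exists x => //; apply: contraNneq y0 => x0; rewrite -ex x0 expr0n.
Qed.

(* With mu = b / lam, x = a + a^-1, z = c + c^-1 and L = q mu lam^2, this solves for
   the parameters of the Verma module: the first two equations encode the lowest
   weight relation and the action of gamma, the third one the action of beta.
   Eliminating x and z leaves a cubic equation in Y = L + L^-1. *)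
Lemma ex_parameters (P Q beta : F) (q mu : F) : q != 0 -> mu != 0 ->
  exists x, exists z, exists2 lam, lam != 0 &
  [/\ x + z * (q * mu * lam ^+ 2) = P * (mu * lam),
      x + z / (q * mu * lam ^+ 2) = Q / (mu * lam) &
      x * z + q * mu * lam ^+ 2 + (q * mu * lam ^+ 2)^-1 = beta].
Proof.
move=> q0 mu0.
set K := P ^+ 2 * mu / q + Q ^+ 2 * q / mu.
have [Y eY] := closed_cubic beta (4%:R - P * Q) (K - 4%:R * beta).
have [L L0 eL] := ex_add_inv Y.
have [lam lam0 elam] : exists2 lam, lam != 0 & lam ^+ 2 = L / (q * mu).
  by apply: ex_sqrt_neq0; rewrite !mulf_neq0 ?invr_neq0 ?mulf_neq0.
have eLl : q * mu * lam ^+ 2 = L by rewrite elam; field; rewrite q0 mu0.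
(* With [x] and [z] given by Cramer's rule from the first two equations, this is
   [x * z = beta - L - L^-1] multiplied by [(L - L^-1) ^+ 2]. In terms of [Y] it is the cubic chosen
   above. *)
have main : (L - L^-1) ^+ 2 * (beta - L - L^-1) = - (K - P * Q * (L + L^-1)).
  have -> : (L - L^-1) ^+ 2 = Y ^+ 2 - 4%:R by rewrite -eL; field.
  have -> : beta - L - L^-1 = beta - Y by rewrite -eL; ring.
  rewrite eL; transitivity (Y ^+ 2 * beta - 4%:R * beta + 4%:R * Y - Y ^+ 3); first by ring.
  by rewrite eY; ring.
have [L1|L1] := eqVneq (L - L^-1) 0; last first.
  exists ((Q / (mu * lam) * L - P * (mu * lam) / L) / (L - L^-1)).
  exists ((P * (mu * lam) - Q / (mu * lam)) / (L - L^-1)).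
  have L2 : L * L - 1 != 0.
    rewrite (_ : L * L - 1 = (L - L^-1) * L); first by rewrite mulf_neq0.
    by field.
  exists lam => //; rewrite eLl; split.
  - by field; rewrite L0 mu0 lam0 L2.
  - by field; rewrite L0 mu0 lam0 L2.
  suff -> : (Q / (mu * lam) * L - P * (mu * lam) / L) / (L - L^-1) *
     ((P * (mu * lam) - Q / (mu * lam)) / (L - L^-1)) = beta - L - L^-1 by ring.
  apply: (mulfI (expf_neq0 2 L1)); rewrite main /K -eLl.
  field; rewrite q0 mu0 lam0 /=.
  suff -> : (q * mu * lam ^+ 2) * (q * mu * lam ^+ 2) - 1 != 0 by [].
  by rewrite eLl.
have LV : L^-1 = L by apply/esym/eqP; rewrite -subr_eq0 L1.
have L2 : L * L = 1 by rewrite -{2}LV mulfV.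
(* L^2 = 1: the system in (x, z) is singular, but the cubic forces its two equations
   to coincide. *)
have lin : P * (mu * lam) = Q / (mu * lam).
  apply/eqP; rewrite -subr_eq0.
  (* Since [L * L = 1], this square equals [L * (K - P * Q * (L + L))], which vanishes by [main]. *)
  suff /eqP : (P * (mu * lam) - Q / (mu * lam)) ^+ 2 = 0 by rewrite expf_eq0.
  move/eqP: main; rewrite L1 expr0n mul0r eq_sym oppr_eq0 LV => /eqP e.
  have e2 : P ^+ 2 * mu / q * L + Q ^+ 2 * q / mu * L = 2%:R * P * Q.
    transitivity (L * (K - P * Q * (L + L)) + 2%:R * P * Q * (L * L)).
      by rewrite /K; ring.
    by rewrite e L2 mulr0 add0r mulr1.
  transitivity (P ^+ 2 * mu / q * (q * mu * lam ^+ 2) + Q ^+ 2 * q / mu * L^-1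
                - 2%:R * P * Q).
    by rewrite -eLl; field; rewrite q0 mu0 lam0.
  by rewrite eLl LV e2 subrr.
(* The first equation gives [x = P * (mu * lam) - z * L]; the third then becomes this quadratic in
   [z]. *)
have [z ez] := closed_quadratic (P * (mu * lam) * L) (L * (L + L - beta)).
exists (P * (mu * lam) - z * L), z, lam => //; rewrite eLl LV -lin.
split; rewrite ?subrK //.
have -> : (P * (mu * lam) - z * L) * z = P * (mu * lam) * z - z ^+ 2 * L by ring.
rewrite ez; transitivity ((1 - L * L) * (P * (mu * lam) * z + L + L) + (L * L) * beta).
  by ring.
by rewrite L2 subrr mul0r add0r mul1r.
Qed.
End Scalars.

(** * Eigenvectors, Schur's lemma and the marginal vector *)

Lemma closed_eigenvector (F : closedFieldType) k n (W : 'M[F]_(k, n)) (T : 'M[F]_n) :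
  W != 0 -> (W *m T <= W)%MS ->
  exists kap, exists2 w : 'rV_n, w != 0 & (w <= W)%MS /\ w *m T = kap *: w.
Proof.
move=> W0 stW; have : (row_base W *m T <= row_base W)%MS.
  by rewrite (eqmxMr T (eq_row_base W)) (submx_trans stW) // eq_row_base.
(* [D] is the matrix of [T] on the span of [W]. Its size is positive because [W] is nonzero, so its
   characteristic polynomial has a root. *)
case/submxP=> D eD.
have /closed_rootP[kap] : size (char_poly D) != 1%N.
  by rewrite size_char_poly eqSS mxrank_eq0.
rewrite -eigenvalue_root_char => /eigenvalueP[y ey y0].
exists kap, (y *m row_base W); last first.
  split; first by rewrite (submx_trans (submxMl _ _)) // eq_row_base.
  by rewrite -mulmxA eD mulmxA ey scalemxAl.
by rewrite -(mul0mx _ (row_base W)) (inj_eq (row_free_inj (row_base_free W))).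
Qed.

Section Module.
Variables (F : closedFieldType) (q : F) (n : nat) (A B C : 'M[F]_n).
Implicit Types al be ga mu : F.

(** Schur's lemma: an eigenspace of [M^T] is stable under the transposed generators and nonzero,
    hence everything. *)
Lemma scalar_of_commuting (M : 'M[F]_n) : is_irreducible A B C ->
  mcomm M A -> mcomm M B -> mcomm M C -> exists c, M = c%:M.
Proof.
move=> [n0 irr] cA cB cC.
have [||c [w w0 [_ ew]]] := @closed_eigenvector _ n n 1%:M M^T.
- by rewrite -mxrank_eq0 mxrank1 -lt0n.
- by rewrite submx1.
have st X : mcomm M X -> stablemx (eigenspace M^T c) X^T.
  by move=> cX; apply: comm_mx_stable_eigenspace; rewrite /comm_mx -!trmx_mul cX.
have /eigenspaceP wE := ew.
have [E0|Ef] := irr _ (st _ cA) (st _ cB) (st _ cC).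
  by rewrite E0 submx0 (negPf w0) in wE.
exists c; apply: trmx_inj; rewrite tr_scalar_mx.
have /eigenspaceP : (1%:M <= eigenspace M^T c)%MS by rewrite submx_full.
by rewrite mul1mx scalemx1.
Qed.

Hypotheses (q0 : q != 0) (q4 : q ^+ 4 != 1).

Let q4' : (q * q) ^+ 2 - 1 != 0.
Proof. by rewrite -expr2 -exprM subr_eq0. Qed.

Lemma C_of_OmC ga : OmC q A B C = ga%:M -> C = ga%:M - qcomm q A B.
Proof. by move=> <-; rewrite addrK. Qed.

(** Substituting [C = ga - qcomm A B] into [OmA] leaves a single term in [B *m B *m A], with
    invertible coefficient [(q ^+ 2 - q ^- 2) ^- 2]. *)
Lemma AW_relation_A al ga : OmA q A B C = al%:M -> OmC q A B C = ga%:M ->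
  B *m B *m A = (q ^+ 2 + q ^- 2) *: (B *m A *m B) - A *m B *m B
    - (q ^+ 2 - q ^- 2) ^+ 2 *: A + ((q ^+ 2 - q ^- 2) ^+ 2 * al)%:M
    - ((q ^+ 2 - q ^- 2) * (q - q^-1) * ga) *: B.
Proof.
move=> hA /C_of_OmC hC; move: hA; rewrite /OmA hC /qcomm.
rewrite mulmxBl mulmxBr mul_scalar_mx mul_mx_scalar -!scalemxAl -!scalemxAr.
rewrite mulmxBl mulmxBr -!scalemxAl -!scalemxAr !mulmxA.
move: (B *m B *m A) (B *m A *m B) (A *m B *m B) => X Y Z.
rewrite -[al%:M]scalemx1 -[(_ * al)%:M]scalemx1 => /matrixP h.
apply/matrixP=> i j; move: {h}(h i j); rewrite !mxE.
move: (X i j) (Y i j) (Z i j) (A i j) (B i j) ((i == j)%:R) => x y z a b e h.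
rewrite -[_ * al * e]mulrA -h; by field; rewrite q0 q4'.
Qed.

(** The same elimination in [OmB] isolates [B *m A *m A]; this yields the action of [B] on each new
    Verma vector. *)
Lemma AW_relation_B be ga : OmB q A B C = be%:M -> OmC q A B C = ga%:M ->
  B *m A *m A = (q ^+ 2 + q ^- 2) *: (A *m B *m A) - A *m A *m B
    - (q ^+ 2 - q ^- 2) ^+ 2 *: B + ((q ^+ 2 - q ^- 2) ^+ 2 * be)%:M
    - ((q ^+ 2 - q ^- 2) * (q - q^-1) * ga) *: A.
Proof.
move=> hB /C_of_OmC hC; move: hB; rewrite /OmB hC /qcomm.
rewrite mulmxBl mulmxBr mul_scalar_mx mul_mx_scalar -!scalemxAl -!scalemxAr.
rewrite mulmxBl mulmxBr -!scalemxAl -!scalemxAr !mulmxA.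
move: (B *m A *m A) (A *m B *m A) (A *m A *m B) => X Y Z.
rewrite -[be%:M]scalemx1 -[(_ * be)%:M]scalemx1 => /matrixP h.
apply/matrixP=> i j; move: {h}(h i j); rewrite !mxE.
move: (X i j) (Y i j) (Z i j) (A i j) (B i j) ((i == j)%:R) => x y z a b e h.
rewrite -[_ * be * e]mulrA -h; by field; rewrite q0 q4'.
Qed.

(* The relation for A, applied to v in V(mu), reads
   (B - theta_1) (B - theta_(-1)) A v = xi v with theta_i = mu q^2i + mu^-1 q^-2i;
   subtracting the marginality equation gives
   (theta_0 - theta_(-1)) (B - theta_1) A v = xi v.  If theta_0 = theta_(-1), then
   xi = 0, so (B - theta_1) A preserves V(mu) and has an eigenvector there. *)
Lemma marginal_eigenvector al ga mu :
  OmA q A B C = al%:M -> OmC q A B C = ga%:M -> is_marginal_weight q A B C mu ->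
  exists kap, exists2 v : 'cV[F]_n, v != 0 &
    B *m v = (mu + mu^-1) *: v /\
    B *m (A *m v) = (mu * q ^+ 2 + mu^-1 * q ^- 2) *: (A *m v) + kap *: v.
Proof.
move=> hA hC [mu0 [v [v0 Bv marg]]].
have rel := AW_relation_A hA hC.
set t0 := mu + mu^-1 in Bv marg *; set t1 := mu * q ^+ 2 + _ in marg *.
pose t' := mu * q ^- 2 + mu^-1 * q ^+ 2.
pose xi := (q ^+ 2 - q ^- 2) ^+ 2 * al - (q ^+ 2 - q ^- 2) * (q - q^-1) * ga * t0.
have main (w : 'cV[F]_n) : B *m w = t0 *: w ->
    B *m (B *m (A *m w)) = (t1 + t') *: (B *m (A *m w)) - (t1 * t') *: (A *m w) + xi *: w.
  move=> Bw; have := congr1 (mulmx^~ w) rel; rewrite /= -!mulmxA => ->.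
  rewrite !mulmxBl mulmxDl -!scalemxAl mul_scalar_mx !mulmxBl -!scalemxAl -!mulmxA.
  rewrite Bw -!scalemxAr Bw -?scalemxAr; move: (B *m (A *m w)) => X; move: (A *m w) => Y.
  apply/matrixP=> i j; rewrite !mxE; move: (X i j) (Y i j) (w i j) => x y z.
  by rewrite /xi /t0 /t1 /t'; field; rewrite mu0 q0.
have marg' : B *m (B *m (A *m v)) = (t0 + t1) *: (B *m (A *m v)) - (t0 * t1) *: (A *m v).
  apply/eqP; rewrite -subr_eq0 -marg -!mulmxA [X in _ == _ *m X]mulmxBl mul_scalar_mx mulmxBl.
  rewrite mulmxBr mul_scalar_mx -scalemxAr; apply/eqP/matrixP=> i j; rewrite !mxE; ring.
have dif : (t0 - t') *: (B *m (A *m v)) = (t0 - t') * t1 *: (A *m v) + xi *: v.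
  have := main v Bv; rewrite marg'; move: (B *m (A *m v)) => X; move: (A *m v) => Y /matrixP h.
  apply/matrixP=> i j; move: (h i j); rewrite !mxE => h'.
  apply/eqP; rewrite -subr_eq0; move/eqP: h'; rewrite -subr_eq0 => /eqP h'.
  by apply/eqP; rewrite -[RHS]h'; ring.
have [tE|tN] := eqVneq (t0 - t') 0; last first.
  exists ((t0 - t')^-1 * xi), v => //; split=> //.
  rewrite -[LHS]scale1r -(mulVf tN) -scalerA dif scalerDr !scalerA.
  by rewrite mulrA mulVf // mul1r.
have xi0 : xi = 0.
  move: dif; rewrite tE mul0r !scale0r add0r => /esym/eqP.
  by rewrite scaler_eq0 (negPf v0) orbF => /eqP.
have E0 : eigenspace B^T t0 != 0.
  have : (v^T <= eigenspace B^T t0)%MS by apply/eigenspaceP; rewrite -trmx_mul Bv linearZ.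
  by apply: contraTneq => ->; rewrite submx0 trmx_eq0.
(* On row vectors, this product is the transpose of [(B - t1) A]. It preserves the eigenspace: with
   [t' = t0] and [xi = 0], [main] says that [B - t0] kills [(B - t1) A w]. *)
have [|kap [w w0 [wE ew]]] := @closed_eigenvector _ _ _ _ (A^T *m (B - t1%:M)^T) E0.
  apply/eigenspaceP/row_matrixP=> i; rewrite row_mul [RHS]linearZ /= row_mul.
  have /eigenspaceP := row_sub i (eigenspace B^T t0); move: (row i _) => u.
  move/(congr1 trmx); rewrite trmx_mul trmxK linearZ /= => /main h.
  apply: trmx_inj; rewrite linearZ /= !trmx_mul !trmxK -(mulmxA _ A) mulmxBl mul_scalar_mx mulmxBr -scalemxAr h.
  have -> : t0 = t' by apply/eqP; rewrite -subr_eq0 tE.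
  rewrite xi0; apply/matrixP=> i' j; rewrite !mxE; ring.
exists kap, w^T; first by rewrite trmx_eq0.
move/eigenspaceP: wE => /(congr1 trmx); rewrite trmx_mul trmxK linearZ /= => Bw.
split=> //; move/(congr1 trmx): ew; rewrite linearZ /= !trmx_mul !trmxK.
by rewrite -mulmxA mulmxBl mul_scalar_mx => <-; rewrite addrC subrK.
Qed.
End Module.

(** * Scalar identities between [theta], [theta_s] and [phi] *)

Lemma sqr_add1_neq0 (F : fieldType) (q : F) : q ^+ 4 != 1 -> q * q + 1 != 0.
Proof.
apply: contraNneq => /eqP; rewrite addr_eq0 => /eqP e.
by rewrite (exprM q 2 2) (expr2 q) e sqrrN expr1n.
Qed.

Section VermaScalars.
Variables (F : fieldType) (q : F).
Hypotheses (q0 : q != 0) (q4 : q ^+ 4 != 1).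
Implicit Types a b c lam u : F.

(* theta_i, theta*_i and phi_i as rational functions of u = q^i. *)
Definition thetaU a lam u := a * lam^-1 * u ^+ 2 + a^-1 * lam * u ^- 2.
Definition phiU a b c lam u :=
  a^-1 * b^-1 * lam * q * (u - u^-1) * (lam^-1 * (u / q) - lam * (q / u))
  * (u^-1 - a * b * c * lam^-1 * (u / q)) * (u^-1 - a * b * c^-1 * lam^-1 * (u / q)).

(** The scalar by which beta acts on the Verma module, the companion of [gammaV]. *)
Definition betaV a b c lam : F :=
  (c + c^-1) * (a + a^-1) + (b + b^-1) * (lam * q + lam^-1 * q^-1).

Lemma thetaE a lam i : theta q a lam i = thetaU a lam (q ^+ i).
Proof. by rewrite /theta /thetaU -!exprM (mulnC i). Qed.

Lemma theta_sE b lam i : theta_s q b lam i = thetaU b lam (q ^+ i).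
Proof. exact: thetaE. Qed.

Lemma phiE a b c lam i : phi q a b c lam i = phiU a b c lam (q ^+ i).
Proof. by []. Qed.

Variables a b c lam u : F.
Hypotheses (a0 : a != 0) (b0 : b != 0) (c0 : c != 0) (lam0 : lam != 0) (u0 : u != 0).

Lemma thetaU_recr :
  (q ^+ 2 + q ^- 2) * thetaU b lam (q * u) - thetaU b lam u = thetaU b lam (q * (q * u)).
Proof. by rewrite /thetaU; field; rewrite q0 lam0 b0 u0. Qed.

Lemma thetaU_quadr :
  thetaU a lam (u / q) ^+ 2 + thetaU a lam u ^+ 2 + (q ^+ 2 - q ^- 2) ^+ 2 =
  (q ^+ 2 + q ^- 2) * (thetaU a lam (u / q) * thetaU a lam u).
Proof. by rewrite /thetaU; field; rewrite q0 lam0 a0 u0. Qed.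

Lemma phiU_gamma :
  (q ^+ 2 + q ^- 2) * (thetaU a lam u * thetaU b lam u
     + thetaU b lam (q * u) * thetaU a lam (q * u) + phiU a b c lam (q * u))
  - (thetaU b lam u * thetaU a lam u + thetaU b lam u * thetaU a lam (q * u)
     + phiU a b c lam u)
  - (q ^+ 2 - q ^- 2) * (q - q^-1) * (gammaV q a b c lam / (q + q^-1))
  - (thetaU a lam u + thetaU a lam (q * u)) * thetaU b lam (q * u)
  = phiU a b c lam (q * (q * u)).
Proof. by rewrite /thetaU /phiU /gammaV; field; rewrite q0 lam0 a0 b0 c0 u0 sqr_add1_neq0. Qed.

Lemma phiU_beta (r := q ^+ 2 + q ^- 2) (s := q ^+ 2 - q ^- 2)
    (t0 := thetaU a lam (u / q)) (t1 := thetaU a lam u) (t2 := thetaU a lam (q * u))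
    (s1 := thetaU b lam u) (f1 := phiU a b c lam u) (f2 := phiU a b c lam (q * u)) :
  r * (t1 * (s1 * t1 + f1) + f2 * t1) - (s1 * t1 ^+ 2 + f1 * t0 + f1 * t1)
  - s ^+ 2 * s1 + s ^+ 2 * (betaV a b c lam / (q + q^-1))
  - s * (q - q^-1) * (gammaV q a b c lam / (q + q^-1)) * t1
  - t1 ^+ 2 * s1 - (t1 + t2) * f2 = 0.
Proof.
rewrite /r /s /t0 /t1 /t2 /s1 /f1 /f2 /betaV /thetaU /phiU /gammaV.
by field; rewrite q0 lam0 a0 b0 c0 u0 sqr_add1_neq0.
Qed.

(** The left side is the Verma value of kappa. It is linear in [a + a^-1] and [c + c^-1], as is
    [gammaV], so prescribing both gives a linear system. *)
Lemma phiU_first (mu := b / lam) :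
  phiU a b c lam q + thetaU a lam 1 * (thetaU b lam 1 - thetaU b lam q) =
  (q - q^-1) * ((a + a^-1) * (lam^-1 * mu^-1 * q^-1 - lam * mu * q)
                - (lam^-1 - lam) * (c + c^-1)).
Proof. by rewrite /mu /thetaU /phiU; field; rewrite q0 lam0 a0 b0 c0 oner_neq0. Qed.
End VermaScalars.

(** Apply the relation to [x1] and compare coefficients: [thetaU_recr] handles [x3], [phiU_gamma]
    handles [x2], [phiU_beta] handles [x1] and [thetaU_quadr] handles [x0]. The hypothesis on
    [A *m x0] carries the factor [phiU] so that it also holds at index 0, where no earlier vector
    exists. *)
Lemma Verma_step (F : fieldType) (q : F) n (A B : 'M[F]_n) (x0 x1 x2 x3 : 'cV[F]_n)
    (a b c lam u : F) (be := betaV q a b c lam / (q + q^-1))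
    (ga := gammaV q a b c lam / (q + q^-1)) :
  q != 0 -> q ^+ 4 != 1 -> a != 0 -> b != 0 -> c != 0 -> lam != 0 -> u != 0 ->
  B *m A *m A = (q ^+ 2 + q ^- 2) *: (A *m B *m A) - A *m A *m B
    - (q ^+ 2 - q ^- 2) ^+ 2 *: B + ((q ^+ 2 - q ^- 2) ^+ 2 * be)%:M
    - ((q ^+ 2 - q ^- 2) * (q - q^-1) * ga) *: A ->
  phiU q a b c lam u *: (A *m x0) = phiU q a b c lam u *: (thetaU a lam (u / q) *: x0 + x1) ->
  A *m x1 = thetaU a lam u *: x1 + x2 ->
  A *m x2 = thetaU a lam (q * u) *: x2 + x3 ->
  B *m x1 = thetaU b lam u *: x1 + phiU q a b c lam u *: x0 ->
  B *m x2 = thetaU b lam (q * u) *: x2 + phiU q a b c lam (q * u) *: x1 ->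
  B *m x3 = thetaU b lam (q * (q * u)) *: x3 + phiU q a b c lam (q * (q * u)) *: x2.
Proof.
move=> q0 q4 a0 b0 c0 lam0 u0 rel.
have id3 := thetaU_recr q0 b0 lam0 u0.
have id2 := phiU_gamma q0 q4 a0 b0 c0 lam0 u0.
have id1 := phiU_beta q0 q4 a0 b0 c0 lam0 u0.
have id0 := thetaU_quadr q0 a0 lam0 u0.
rewrite -/be -/ga in id1 id2; cbv zeta in id1.
(* All scalars become opaque: only the four identities are used from here on. *)
move: be ga (thetaU a lam (u / q)) (thetaU a lam u) (thetaU a lam (q * u))
  (thetaU b lam u) (thetaU b lam (q * u)) (thetaU b lam (q * (q * u)))
  (phiU q a b c lam u) (phiU q a b c lam (q * u)) (phiU q a b c lam (q * (q * u)))
  rel id0 id1 id2 id3 => be' ga' t0 t1 t2 s1 s2 s3 f1 f2 f3.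
move: (q ^+ 2 + q ^- 2) (q ^+ 2 - q ^- 2) (q - q^-1) => r s g.
move=> rel id0 id1 id2 id3 A0 A1 A2 B1 B2.
have ABx1 : A *m (B *m x1) = s1 *: (t1 *: x1 + x2) + f1 *: (t0 *: x0 + x1).
  by rewrite B1 mulmxDr -!scalemxAr A1 A0.
have AABx1 : A *m (A *m (B *m x1)) =
    s1 *: (t1 *: (t1 *: x1 + x2) + (t2 *: x2 + x3))
    + (t0 *: (f1 *: (t0 *: x0 + x1)) + f1 *: (t1 *: x1 + x2)).
  rewrite -A0.
  rewrite ABx1 !(mulmxDr, =^~ scalemxAr) A1 A2.
  by move: (A *m x0) => y0; apply/matrixP=> i j; rewrite !mxE; ring.
have BAx1 : B *m (A *m x1) = t1 *: (B *m x1) + B *m x2.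
  by rewrite A1 mulmxDr -scalemxAr.
have ABAx1 : A *m (B *m (A *m x1)) =
    t1 *: (A *m (B *m x1)) + (s2 *: (t2 *: x2 + x3) + f2 *: (t1 *: x1 + x2)).
  by rewrite BAx1 mulmxDr -scalemxAr B2 mulmxDr -!scalemxAr A1 A2.
have BAAx1 : B *m (A *m (A *m x1)) =
    t1 *: (t1 *: (B *m x1) + B *m x2) + (t2 *: (B *m x2) + B *m x3).
  by rewrite A1 mulmxDr -scalemxAr A1 A2 !(mulmxDr, =^~ scalemxAr).
have := congr1 (mulmx^~ x1) rel; rewrite /= !(mulmxDl, mulNmx) -!scalemxAl mul_scalar_mx.
rewrite -!mulmxA BAAx1 ABAx1 AABx1 ABx1 A1 B1 B2.
move: (B *m x3) => Bx3 /matrixP h; apply/matrixP=> i j; move: {h}(h i j).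
rewrite !mxE; move: (x0 i j) (x1 i j) (x2 i j) (x3 i j) (Bx3 i j) => y0 y1 y2 y3 z h.
move/eqP: h; rewrite -subr_eq0 => /eqP h.
apply/eqP; rewrite -subr_eq0; apply/eqP.
move/eqP: id0; rewrite -subr_eq0 => /eqP id0.
have lin e e' e'' : e = 0 -> e' = 0 -> e'' = 0 -> e + e' * y1 - f1 * e'' * y0 = 0.
  by move=> -> -> ->; ring.
by rewrite -[RHS](lin _ _ _ h id1 id0) -id3 -id2; ring.
Qed.

(** * The Verma basis inside the module and the isomorphism *)

Section VermaModule.
Variables (F : closedFieldType) (q : F) (n' : nat).
Let n := n'.+1.
Variables (A B C : 'M[F]_n) (a b c lam : F) (v : 'cV[F]_n).
Hypotheses (q0 : q != 0) (q4 : q ^+ 4 != 1) (qn : (q ^+ n) ^+ 2 = 1).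
Hypotheses (a0 : a != 0) (b0 : b != 0) (c0 : c != 0) (lam0 : lam != 0).
Hypotheses (irr : is_irreducible A B C) (v0 : v != 0).
Hypothesis hB : OmB q A B C = (betaV q a b c lam / (q + q^-1))%:M.
Hypothesis hC : OmC q A B C = (gammaV q a b c lam / (q + q^-1))%:M.
Hypothesis Bv : B *m v = theta_s q b lam 0 *: v.
Hypothesis BAv : B *m (A *m v) = theta_s q b lam 1 *: (A *m v)
  + (phi q a b c lam 1 + theta q a lam 0 * (theta_s q b lam 0 - theta_s q b lam 1)) *: v.

(** Writing the Verma vectors as polynomials in [A] applied to [v] gives access to Cayley-Hamilton
    and to commutation with [A]. *)
Definition Verma_poly i : {poly F} := \prod_(0 <= j < i) ('X - (theta q a lam j)%:P).
Definition Verma_vec i : 'cV[F]_n := horner_mx A (Verma_poly i) *m v.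
Local Notation p := Verma_poly.
Local Notation m := Verma_vec.

Lemma Verma_vec0 : m 0 = v.
Proof. by rewrite /m /p big_geq // rmorph1 mul1mx. Qed.

Lemma A_Verma_vec i : A *m m i = theta q a lam i *: m i + m i.+1.
Proof.
rewrite /m /p big_nat_recr //= mulrC rmorphM rmorphB /= horner_mx_X horner_mx_C.
by rewrite -mulmxE -mulmxA mulmxBl mul_scalar_mx addrC subrK.
Qed.

Lemma phi0 : phi q a b c lam 0 = 0.
Proof. by rewrite /phi expr0 invr1 subrr mulr0 !mul0r. Qed.

Lemma B_Verma_vec i : B *m m i = theta_s q b lam i *: m i + phi q a b c lam i *: m i.-1.
Proof.
have B1 : B *m m 1 = theta_s q b lam 1 *: m 1 + phi q a b c lam 1 *: m 0.
  have -> : m 1 = A *m v - theta q a lam 0 *: v.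
    by rewrite -Verma_vec0 A_Verma_vec addrC addKr.
  rewrite mulmxBr -scalemxAr BAv Bv Verma_vec0.
  by apply/matrixP=> i0 j; rewrite !mxE; ring.
(* The relation has degree two in [A], so the induction carries two consecutive indices. At [k = 0]
   the predecessor [k.-1] is 0, harmless since [phi] vanishes there. *)
suff H : forall k, B *m m k = theta_s q b lam k *: m k + phi q a b c lam k *: m k.-1 /\
    B *m m k.+1 = theta_s q b lam k.+1 *: m k.+1 + phi q a b c lam k.+1 *: m k.
  by case: (H i).
elim=> [|k [IH1 IH2]]; first by split=> //; rewrite phi0 scale0r addr0 Verma_vec0.
split=> //; have u0 : q ^+ k != 0 by rewrite expf_neq0.
rewrite theta_sE phiE !exprS.
apply: (@Verma_step F q n A B (m k.-1) (m k) _ _ a b c lam (q ^+ k)) => //.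
- exact: AW_relation_B hB hC.
- case: k u0 {IH1 IH2} => [|k] _.
    by rewrite -phiE phi0 !scale0r.
  by rewrite A_Verma_vec thetaE exprS (mulrC q) mulfK.
- by rewrite -thetaE A_Verma_vec.
- by rewrite -exprS -thetaE A_Verma_vec.
- by rewrite IH1 theta_sE phiE.
by rewrite IH2 theta_sE phiE !exprS.
Qed.

Definition Verma_mx : 'M[F]_n := \matrix_(i, j) m j i 0.

Lemma col_Verma_mx (j : 'I_n) : col j Verma_mx = m j.
Proof. by apply/matrixP=> i k; rewrite !mxE ord1. Qed.

(** The monic polynomials [p k] with [k < n] have degree [k], so they span all polynomials of degree
    below [n]; division by the characteristic polynomial reduces [r] to that case. *)
Lemma horner_in_span (r : {poly F}) : ((horner_mx A r *m v)^T <= Verma_mx^T)%MS.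
Proof.
have small k : (k <= n)%N -> forall s : {poly F}, (size s <= k)%N ->
    ((horner_mx A s *m v)^T <= Verma_mx^T)%MS.
  elim: k => [|k IHk] lekn s.
    by rewrite leqn0 size_poly_eq0 => /eqP->; rewrite rmorph0 mul0mx trmx0 sub0mx.
  move=> les; have pk : p k \is monic by apply: monic_prod_XsubC.
  have sp : size (p k) = k.+1 by rewrite size_prod_XsubC size_iota subn0.
  rewrite -(subrK (s`_k *: p k) s) rmorphD /= mulmxDl linearD /= addmx_sub //.
    apply: IHk; first exact: ltnW.
    apply/leq_sizeP=> j; rewrite leq_eqVlt coefB coefZ => /predU1P[<-|ltkj].
      by move: pk; rewrite monicE lead_coefE sp => /eqP->; rewrite mulr1 subrr.
    by rewrite (nth_default _ (leq_trans les ltkj)) (@nth_default _ _ (p k)) ?sp // mulr0 subrr.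
  rewrite linearZ /= -scalemxAl linearZ /= scalemx_sub //.
  by rewrite (eq_row_sub (Ordinal lekn)) // -tr_col col_Verma_mx.
have ch0 : char_poly A != 0 by rewrite monic_neq0 ?char_poly_monic.
rewrite (divp_eq r (char_poly A)) rmorphD rmorphM /= Cayley_Hamilton mulr0 add0r.
apply: (small n) => //; rewrite -ltnS -(size_char_poly A); exact: ltn_modpN0.
Qed.

(** The span of the columns contains [v] and is stable under [A], [B] and hence [C], so
    irreducibility makes it the whole space. *)
Lemma Verma_mx_unit : Verma_mx \in unitmx.
Proof.
have st X : (forall j, ((X *m m j)^T <= Verma_mx^T)%MS) -> stablemx Verma_mx^T X^T.
  move=> h; apply/row_subP=> j; rewrite row_mul -tr_col col_Verma_mx -trmx_mul; exact: h.
have hm j : ((m j)^T <= Verma_mx^T)%MS by exact: horner_in_span.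
have stA : stablemx Verma_mx^T A^T.
  by apply: st => j; rewrite A_Verma_vec linearD linearZ /= addmx_sub ?scalemx_sub.
have stB : stablemx Verma_mx^T B^T.
  by apply: st => j; rewrite B_Verma_vec linearD !linearZ /= addmx_sub ?scalemx_sub.
have stM X Y : stablemx Verma_mx^T X^T -> stablemx Verma_mx^T Y^T ->
    stablemx Verma_mx^T (X *m Y)^T.
  by move=> sX sY; rewrite trmx_mul; apply: stablemxM.
have stC : stablemx Verma_mx^T C^T.
  have -> : C^T = (gammaV q a b c lam / (q + q^-1))%:M
      - (q ^+ 2 - q ^- 2)^-1 *: (q *: (A *m B)^T - q^-1 *: (B *m A)^T).
    by rewrite (C_of_OmC hC) /qcomm linearB linearZ /= linearB !linearZ /= tr_scalar_mx.
  have stZ k X : stablemx Verma_mx^T X -> stablemx Verma_mx^T (k *: X).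
    by move=> sX; rewrite -scalemxAr scalemx_sub.
  by rewrite stablemxD ?stablemxC // stablemxN stZ // stablemxD ?stablemxN ?stZ ?stM.
have [E|] := irr.2 _ stA stB stC; last by rewrite row_full_unit unitmx_tr.
have := hm 0; rewrite E submx0 Verma_vec0 trmx_eq0 => /eqP vE.
by have := v0; rewrite vE eqxx.
Qed.

Lemma qn_periodic i : (q ^+ (n + i)) ^+ 2 = (q ^+ i) ^+ 2.
Proof. by rewrite exprD exprMn qn mul1r. Qed.

Lemma theta_periodic x i : theta q x lam (n + i) = theta q x lam i.
Proof. by rewrite !thetaE /thetaU qn_periodic. Qed.

Lemma theta_s_periodic x i : theta_s q x lam (n + i) = theta_s q x lam i.
Proof. exact: theta_periodic. Qed.

(** [q ^+ n] is 1 or -1, and [phiU] is even in [u]: its four factors involving [u] are all odd. *)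
Lemma phi_periodic i : phi q a b c lam (n + i) = phi q a b c lam i.
Proof.
have /eqP := qn.
rewrite !phiE exprD /phiU sqrf_eq1 => /orP[]/eqP->.
  by rewrite mul1r.
have u0 : q ^+ i != 0 by rewrite expf_neq0.
by field; rewrite u0 q0 a0 b0 c0 lam0 oppr_eq0 oner_neq0.
Qed.

(** By periodicity of [theta], the factors of [p (n + i)] after the first [n] are those of [p i]. *)
Lemma Verma_vec_shift i : m (n + i) = horner_mx A (p n) *m m i.
Proof.
rewrite /m mulmxA mulmxE -rmorphM /=; congr (horner_mx A _ *m v).
rewrite /p (@big_cat_nat _ _ _ n) ?leq_addr //=; congr (_ * _).
rewrite -{1}[n]add0n big_addn addKn; apply: eq_bigr => j _.
by rewrite addnC theta_periodic.
Qed.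

Lemma Verma_vec_top : exists delta, m n = delta *: v.
Proof.
set X := horner_mx A (p n).
have cXA : mcomm X A.
  by have := congr1 (horner_mx A) (mulrC (p n) 'X); rewrite !rmorphM /= horner_mx_X.
have cXB : mcomm X B.
  (* Commutation with [B] is tested on the basis of Verma vectors, which [X] shifts by [n]. *)
  suff E : (X *m B) *m Verma_mx = (B *m X) *m Verma_mx.
    by rewrite /mcomm -[LHS](mulmxK Verma_mx_unit) E mulmxK ?Verma_mx_unit.
  have colE (M : 'M[F]_n) (j : 'I_n) : col j (M *m Verma_mx) = M *m m j.
    by rewrite -col_Verma_mx !colE mulmxA.
  apply: trmx_inj; apply/row_matrixP=> j; rewrite -!tr_col !colE; congr (_^T).
  rewrite -!mulmxA B_Verma_vec mulmxDr -!scalemxAr -!Verma_vec_shift B_Verma_vec.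
  rewrite theta_s_periodic phi_periodic; case: (j : nat) => [|k].
    by rewrite phi0 !scale0r.
  by rewrite addnS.
have cXC : mcomm X C.
  rewrite (C_of_OmC hC) /mcomm /qcomm mulmxBr mulmxBl scalar_mxC; congr (_ - _).
  rewrite -scalemxAl -scalemxAr !(mulmxBl, mulmxBr) -!scalemxAl -!scalemxAr.
  by rewrite !mulmxA cXA cXB -!mulmxA cXA cXB.
have [delta E] := scalar_of_commuting irr cXA cXB cXC.
by exists delta; rewrite -[in LHS](addn0 n) Verma_vec_shift Verma_vec0 -/X E mul_scalar_mx.
Qed.

(** Reads off a column of [Verma_mx] times a sparse matrix. The value 0 occurs for [t = n], the
    missing subdiagonal entry of the last column of [W_A]. *)
Lemma sum_pick i t x :
  \sum_(k < n) m k i 0 * ((k == t :> nat)%:R * x) = if (t < n)%N then m t i 0 * x else 0.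
Proof.
case: ltnP => [tn|nt]; last first.
  rewrite big1 // => k _; rewrite ltn_eqF ?mul0r ?mulr0 //.
  exact: leq_trans (ltn_ord k) nt.
rewrite (bigD1 (Ordinal tn)) //= eqxx mul1r big1 ?addr0 // => k.
by rewrite -val_eqE /= => /negPf->; rewrite mul0r mulr0.
Qed.

Lemma W_isomorphic : exists delta,
  mod_isomorphic (W_A q n a lam delta) (W_B q n a b c lam) (W_C q n a b c lam delta) A B C.
Proof.
have [delta top] := Verma_vec_top; exists delta, Verma_mx; first exact: Verma_mx_unit.
have colM (M : 'M[F]_n) i (j : 'I_n) : (M *m Verma_mx) i j = (M *m m j) i 0.
  by rewrite -col_Verma_mx colE mulmxA -colE [RHS]mxE.
have entry (W : 'M[F]_n) i (j : 'I_n) : (Verma_mx *m W) i j = \sum_(k < n) m k i 0 * W k j.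
  by rewrite mxE; apply: eq_bigr => k _; rewrite mxE.
have PA : Verma_mx *m W_A q n a lam delta = A *m Verma_mx.
  apply/matrixP=> i j; rewrite colM A_Verma_vec entry.
  have WE k : W_A q n a lam delta k j = (k == j :> nat)%:R * theta q a lam j
      + ((k == j.+1 :> nat)%:R * 1 + (k == 0%N :> nat)%:R * ((j == n.-1 :> nat)%:R * delta)).
    by rewrite mxE mulr1 addrA mulrA -natrM mulnb.
  under eq_bigr => k _ do rewrite WE mulrDr [X in _ + X]mulrDr.
  rewrite !big_split /= !sum_pick ltn_ord mulr1 [RHS]mxE [X in _ = X + _]mxE.
  rewrite [X in _ = X + _]mulrC; congr (_ + _).
  (* In the last column the corner entry [delta] replaces the subdiagonal one, matching
     [m n = delta *: v]. *)
  have [->|jn] := eqVneq (j : nat) n.-1; first by rewrite /= ?eqxx !ltnn add0r top Verma_vec0 [RHS]mxE mul1r mulrC.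
  by rewrite ltn_neqAle ltn_ord eqSS jn /= mul0r mulr0 addr0.
have PB : Verma_mx *m W_B q n a b c lam = B *m Verma_mx.
  apply/matrixP=> i j; rewrite colM B_Verma_vec entry.
  have WE k : W_B q n a b c lam k j = (k == j :> nat)%:R * theta_s q b lam j
      + (k.+1 == j :> nat)%:R * phi q a b c lam j by rewrite mxE.
  under eq_bigr => k _ do rewrite WE mulrDr.
  rewrite big_split /= sum_pick ltn_ord [RHS]mxE [X in _ = X + _]mxE [X in _ = _ + X]mxE.
  rewrite [X in _ = X + _]mulrC; congr (_ + _); case: j {WE} => [[|j] ltj] /=.
    by rewrite phi0 [RHS]mul0r big1 // => k _; rewrite !mulr0.
  under eq_bigr => k _ do rewrite eqSS.
  by rewrite sum_pick ltnW // mulrC.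
split=> //; rewrite (C_of_OmC hC) /W_C /qcomm.
rewrite mulmxBr mulmxBl scalar_mxC; congr (_ - _).
rewrite -scalemxAl -scalemxAr !(mulmxBl, mulmxBr) -!scalemxAl -!scalemxAr.
by rewrite !mulmxA PA PB -!mulmxA PA PB.
Qed.
End VermaModule.

(** * Choice of the parameters and conclusion *)

Lemma W_of_marginal_weight (F : closedFieldType) (q : F) n' (A B C : 'M[F]_n'.+1) mu :
  q != 0 -> q ^+ 4 != 1 -> (q ^+ n'.+1) ^+ 2 = 1 ->
  is_DeltaQ_module q A B C -> is_irreducible A B C -> is_marginal_weight q A B C mu ->
  exists (a b c lam delta : F), [/\ a != 0, b != 0, c != 0, lam != 0 &
    mod_isomorphic (W_A q n'.+1 a lam delta) (W_B q n'.+1 a b c lam)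
                   (W_C q n'.+1 a b c lam delta) A B C].
Proof.
move=> q0 q4 qn hmod irr marg; have mu0 := marg.1.
have scal Om : Om \in [:: OmA q A B C; OmB q A B C; OmC q A B C] -> exists x, Om = x%:M.
  by move=> /hmod[]; apply: scalar_of_commuting.
have [|al hA] := scal (OmA q A B C); first by rewrite !inE eqxx.
have [|be hB] := scal (OmB q A B C); first by rewrite !inE eqxx orbT.
have [|ga hC] := scal (OmC q A B C); first by rewrite !inE eqxx !orbT.
have [kap [v v0 [Bv BAv]]] := marginal_eigenvector q0 q4 hA hC marg.
have q2 : q * q + 1 != 0 by apply: sqr_add1_neq0.
have qB : q * q - 1 != 0.
  by apply: contraNneq q4 => /eqP; rewrite subr_eq0 (exprM q 2 2) (expr2 q) => /eqP->; rewrite expr1n.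
have qD0 : q + q^-1 != 0.
  by rewrite (_ : q + q^-1 = (q * q + 1) / q) ?mulf_neq0 ?invr_neq0 //; field.
(* [P] and [Q] solve [P + Q = ga * (q + q^-1)] and [q^-1 * P - q * Q = kap']. They are to become
   [x / b + z * lam * q] and [x * b + z / (q * lam)]. *)
pose kap' := kap / (q - q^-1).
pose P := (kap' + q * (ga * (q + q^-1))) / (q + q^-1).
pose Q := (q^-1 * (ga * (q + q^-1)) - kap') / (q + q^-1).
(* With [b = mu * lam], the terms [mu / q] and [q / mu] of [betaV] do not depend on [lam]; they are
   moved to the right side. *)
have [x [z [lam lam0 [eP eQ eb]]]] :=
  ex_parameters P Q (be * (q + q^-1) - mu / q - q / mu) q0 mu0.
have [a a0 ea] := ex_add_inv x; have [c c0 ec] := ex_add_inv z.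
pose b := mu * lam; have b0 : b != 0 by rewrite mulf_neq0.
have eP' : x / (mu * lam) + z * lam * q = P.
  by apply: (mulIf b0); rewrite -eP /b; field; rewrite mu0 lam0.
have eQ' : x * (mu * lam) + z / (q * lam) = Q.
  apply: (mulIf (invr_neq0 b0)); rewrite -[RHS]eQ /b; field; rewrite mu0 lam0 q0 //.
have gaE : gammaV q a b c lam / (q + q^-1) = ga.
  have -> : gammaV q a b c lam = P + Q.
    by rewrite -eP' -eQ' /gammaV ea ec /b; field; rewrite mu0 lam0 q0.
  by rewrite /P /Q; field; rewrite q0 q2.
have beE : betaV q a b c lam / (q + q^-1) = be.
  apply: (mulIf qD0); rewrite divfK //; apply/eqP; rewrite -subr_eq0.
  move/eqP: eb; rewrite -subr_eq0 => /eqP eb; rewrite -[X in _ == X]eb /betaV ea ec /b.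
  by apply/eqP; field; rewrite mu0 lam0 q0.
have kapE : phi q a b c lam 1 + theta q a lam 0 * (theta_s q b lam 0 - theta_s q b lam 1) = kap.
  rewrite phiE thetaE !theta_sE expr0 expr1 phiU_first // ea ec.
  have -> : kap = (q - q^-1) * (q^-1 * P - q * Q).
    by rewrite /P /Q /kap'; field; rewrite q0 q2 qB.
  by rewrite -eP' -eQ' /b; field; rewrite mu0 lam0 q0.
have bE : b / lam = mu by rewrite mulfK.
have bE' : b^-1 * lam = mu^-1 by rewrite -bE invf_div mulrC.
have [||||delta iso] := @W_isomorphic F q n' A B C a b c lam v q0 q4 qn a0 b0 c0 lam0 irr v0.
- by rewrite beE.
- by rewrite gaE.
- by rewrite Bv /theta_s bE bE' muln0 expr0 invr1 !mulr1.
- by rewrite BAv kapE /theta_s bE bE'.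
by exists a, b, c, lam, delta.
Qed.

Theorem theorem1p9 (F : closedFieldType) (q : F) (d : nat)
  (hq : d.-primitive_root q)
  (hd : d \notin [:: 1%N; 2%N; 4%N])
  (A B C : 'M[F]_(dprime d))
  (hmod : is_DeltaQ_module q A B C)
  (hirr : is_irreducible A B C)
  (hmarg : exists mu : F, is_marginal_weight q A B C mu) :
  exists (a b c lam delta : F),
    [/\ a != 0, b != 0, c != 0, lam != 0 &
      mod_isomorphic (W_A q (dprime d) a lam delta)
                     (W_B q (dprime d) a b c lam)
                     (W_C q (dprime d) a b c lam delta) A B C].
Proof.
have d0 := prim_order_gt0 hq.
have q0 : q != 0 by rewrite (prim_root_eq0 hq) -lt0n.
have q4 : q ^+ 4 != 1.
  apply: contra hd => /eqP q4; have : (d %| 4)%N by rewrite (prim_order_dvd hq) q4.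
  by move=> /[dup] /dvdn_leq; case: d d0 {hq hirr hmod hmarg A B C} => [|[|[|[|[|]]]]].
have qn : (q ^+ dprime d) ^+ 2 = 1.
  rewrite -exprM /dprime; case: ifP => [_|/negbT od].
    by rewrite exprM (prim_expr_order hq) expr1n.
  by rewrite muln2 halfK (negPf od) subn0 (prim_expr_order hq).
have [mu marg] := hmarg.
move: A B C hmod hirr marg {hmarg} qn; case: (dprime d) => [|n'] A B C hmod hirr marg qn.
  by have := hirr.1.
exact: (W_of_marginal_weight q0 q4 qn hmod hirr marg).
Qed.
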